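(* Let $W=(W,S)$ be a Coxeter group. A building of type $W$ is equivalently a strict $W$-groupoid on a connected simply connected groupoid, in the following sense. (a) Let $(\Delta,\delta)$ be a building of type $W$, and let $\mathcal{G}$ be the connected simply connected groupoid with set of objects $\mathcal{G}_0=\Delta$ (so for all $C,D\in\Delta$ there is exactly one edge from $C$ to $D$). Then the function $\delta':\mathcal{G}\to W$ defined on edges by $\delta'(g)=\delta(\iota(g),\tau(g))$ is a strict $W$-groupoid. (b) Conversely, let $\delta:\mathcal{G}\to W$ be a strict $W$-groupoid on a connected simply connected groupoid $\mathcal{G}$. Put $\Delta=\mathcal{G}_0$ and define $\delta':\Delta\times\Delta\to W$ by $\delta'(C,D)=\delta(g)$, where $g$ is the unique edge of $\mathcal{G}$ from $C$ to $D$. Then $(\Delta,\delta')$ is a building of type $W$.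
   Context: $W=(W,S)$ is a Coxeter group with generating set $S$, and $\leq$ is the Bruhat order on $W$ (so for $s\in S$, $ws<w$ iff the word length of $ws$ is less than that of $w$). $\mathcal{G}=(\mathcal{G}_0,\mathcal{G}_1)$ denotes a small groupoid with objects $\mathcal{G}_0$ (called chambers) and morphisms $\mathcal{G}_1$ (called edges); $\iota(g),\tau(g)$ are the source and target of the edge $g$. If $\tau(g)=\iota(h)$, then $gh$ denotes the composite ''first $g$, then $h$'', i.e. $gh=h\circ g$. $\mathcal{G}$ is simply connected if all its local (vertex) groups are trivial, and connected if any two chambers are joined by an edge. A function $\delta:\mathcal{G}\to W$ means a function of sets $\mathcal{G}_1\to W$. A $W$-groupoid on $\mathcal{G}$ is a function $\delta:\mathcal{G}\to W$ which is weak (for every chamber $C$ and every $s\in S$ there is an edge $g$ with $\iota(g)=C$ and $\delta(g)=s$) and satisfies: (WG1) $\delta(1)=1$ for every identity edge $1$; (WG2) for all edges $g,h$ such that $gh$ is defined, $\delta(gh)\geq\delta(g)\delta(h)$; (WG3) for every edge $g$ and every $s\in S$ with $\delta(g)s<\delta(g)$, there exists an edge $h$ with $\iota(h)=\iota(g)$, $\delta(h^{-1}g)=s$ and $\delta(h)=\delta(g)s$. It is strict if $\delta(g)=1$ implies that $g$ is an identity edge. A building $(\Delta,\delta)$ of type $W$ is a set $\Delta$ (of chambers) with a function $\delta:\Delta\times\Delta\to W$ such that for all $C,D\in\Delta$: (WD1) $C=D$ if and only if $\delta(C,D)=1$; (WD2) if $\delta(C,D)=w$ and $D'\in\Delta$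 satisfies $\delta(D,D')=s\in S$, then (i) if $ws<w$, then $\delta(C,D')\in\{ws,w\}$; (ii) if $ws>w$, then $\delta(C,D')=ws$; (WD3) if $\delta(C,D)=w$, then for all $s\in S$ there exists $D'\in\Delta$ such that $\delta(D,D')=s$ and $\delta(C,D')=ws$. *)

(* Defs.v *)
From HB Require Import structures.
From Stdlib Require Import Relations.
From mathcomp Require Import all_boot.
From mathcomp Require Import boolp classical_sets.
Set Implicit Arguments.
Unset Strict Implicit.
Unset Printing Implicit Defensive.
Local Open Scope group_scope.

(** * Coxeter groups

    [groupType] is MathComp's class of arbitrary, possibly infinite, groups. *)

Section Coxeter.
Variables (W : groupType) (S : set W).

(** Words in the alphabet [S]. *)
Definition is_word (u : seq W) : Prop := forall x, x \in u -> S x.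

Definition word_value (u : seq W) : W := \big[*%g/1]_(x <- u) x.

(** In a Coxeter matrix the entry oo is encoded by 0.  With this convention
    the relation [(s * t) ^+ m s t = 1] is vacuous exactly for infinite
    entries. *)
Definition coxeter_matrix (m : W -> W -> nat) : Prop :=
  forall s t, S s -> S t ->
    [/\ m s s = 1%N, m s t = m t s & s <> t -> m s t <> 1%N].

(** The word [(s t)^k]. *)
Definition relator (s t : W) (k : nat) : seq W := flatten (nseq k [:: s; t]).

(** Insertion of one of the defining relators in a word.  Since [m s s = 1],
    the relators include [s s], so that every letter is its own formal inverse
    and words in [S] suffice, without letters [s^-1]. *)
Inductive insert_relator (m : W -> W -> nat) : seq W -> seq W -> Prop :=
  InsertRelator u v s t of is_word u & is_word v & S s & S t :
    insert_relator m (u ++ v) (u ++ relator s t (m s t) ++ v).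

(** [W] has the presentation [< S | (s t)^(m s t) = 1 >]: [S] generates [W],
    the relations hold in [W], and every word that is trivial in [W] can be
    reduced to the empty word by inserting and deleting relators. *)
Definition has_presentation (m : W -> W -> nat) : Prop :=
  [/\ forall w : W, exists2 u, is_word u & word_value u = w,
      forall s t, S s -> S t -> (s * t) ^+ m s t = 1
    & forall u, is_word u -> word_value u = 1 ->
        clos_refl_sym_trans _ (insert_relator m) u [::]].

Definition coxeter_system : Prop :=
  exists2 m, coxeter_matrix m & has_presentation m.

(** Word length: the least size of a word in [S] with value [w]; the default
    value 0 of [xget] is irrelevant as soon as [S] generates [W] as a monoid. *)
Definition has_expression (w : W) (n : nat) : Prop :=
  exists u, [/\ is_word u, word_value u = w & size u = n].

Definition word_length (w : W) : nat :=
  xget 0%N [set n | has_expression w n /\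
                    forall k, has_expression w k -> n <= k]%classic.

(** Recall that [s ^ x] is the conjugate [x^-1 * s * x]. *)
Definition reflection (t : W) : Prop := exists s x, S s /\ t = s ^ x.

Definition bruhat_step (u v : W) : Prop :=
  exists t, [/\ reflection t, v = u * t & word_length u < word_length v].

Definition bruhat_le : W -> W -> Prop := clos_refl_trans W bruhat_step.

Definition bruhat_lt (u v : W) : Prop := bruhat_le u v /\ u <> v.

End Coxeter.

(** * Groupoids

    A groupoid with set of chambers [Delta] is given by its sets of edges
    [edge C D], with source [C] and target [D].  Composition is written in
    diagrammatic order: [comp g h] is "first [g], then [h]". *)

Record groupoid (Delta : Type) := Groupoid {
  edge : Delta -> Delta -> Type;
  ident : forall C, edge C C;
  comp : forall C D E, edge C D -> edge D E -> edge C E;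
  inv : forall C D, edge C D -> edge D C;
  compA : forall C D E F (g : edge C D) (h : edge D E) (k : edge E F),
    comp g (comp h k) = comp (comp g h) k;
  comp1g : forall C D (g : edge C D), comp (ident C) g = g;
  compg1 : forall C D (g : edge C D), comp g (ident D) = g;
  compVg : forall C D (g : edge C D), comp (inv g) g = ident D;
  compgV : forall C D (g : edge C D), comp g (inv g) = ident C
}.

Arguments edge {Delta}.
Arguments ident {Delta} G C : rename.
Arguments comp {Delta G C D E} : rename.
Arguments inv {Delta G C D} : rename.

Section GroupoidTheory.
Variables (Delta : Type) (G : groupoid Delta).

Definition connected : Prop := forall C D, inhabited (edge G C D).

Definition simply_connected : Prop := forall C (g : edge G C C), g = ident G C.

Inductive is_identity : forall C D, edge G C D -> Prop :=
  IsIdentity C : is_identity (ident G C).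

(** In a connected groupoid, some edge from [C] to [D]; it is the unique one
    when the groupoid is simply connected, see [the_edge_unique]. *)
Definition the_edge (cG : connected) (C D : Delta) : edge G C D :=
  inhabited_witness (cG C D).

Lemma the_edge_unique (cG : connected) (sG : simply_connected) C D
  (g : edge G C D) : g = the_edge cG C D.
Proof.
set h := the_edge cG C D.
by rewrite -[g]compg1 -(compVg h) compA (sG _ (comp g (inv h))) comp1g.
Qed.

End GroupoidTheory.

(** Every set is the set of chambers of a connected simply connected
    groupoid. *)
Lemma connected_simply_connected_groupoid (Delta : Type) :
  exists2 G : groupoid Delta, connected G & simply_connected G.
Proof.
unshelve eexists (@Groupoid Delta (fun _ _ => unit) (fun _ => tt)
  (fun _ _ _ _ _ => tt) (fun _ _ _ => tt) _ _ _ _ _).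
all: by [|move=> C D [] | move=> C D; exists | move=> C []].
Qed.

(** * W-groupoids and buildings *)

Section WGroupoid.
Variables (W : groupType) (S : set W).
Variables (Delta : Type) (G : groupoid Delta).

(** A function on the set of all edges of [G]; source and target are
    implicit. *)
Variable delta : forall C D, edge G C D -> W.
Arguments delta {C D}.

Definition weak : Prop :=
  forall C s, S s -> exists D (g : edge G C D), delta g = s.

Definition WG1 : Prop := forall C, delta (ident G C) = 1.

Definition WG2 : Prop :=
  forall C D E (g : edge G C D) (h : edge G D E),
    bruhat_le S (delta g * delta h) (delta (comp g h)).

Definition WG3 : Prop :=
  forall C D (g : edge G C D) s, S s ->
    bruhat_lt S (delta g * s) (delta g) ->
    exists E (h : edge G C E),
      delta (comp (inv h) g) = s /\ delta h = delta g * s.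

Definition W_groupoid : Prop := [/\ weak, WG1, WG2 & WG3].

Definition strict : Prop :=
  forall C D (g : edge G C D), delta g = 1 -> is_identity g.

Definition strict_W_groupoid : Prop := W_groupoid /\ strict.

End WGroupoid.

Section Building.
Variables (W : groupType) (S : set W).
Variables (Delta : Type) (delta : Delta -> Delta -> W).

Definition WD1 : Prop := forall C D, C = D <-> delta C D = 1.

Definition WD2 : Prop :=
  forall C D D' w s, delta C D = w -> S s -> delta D D' = s ->
    (bruhat_lt S (w * s) w -> delta C D' = w * s \/ delta C D' = w) /\
    (bruhat_lt S w (w * s) -> delta C D' = w * s).

Definition WD3 : Prop :=
  forall C D w s, delta C D = w -> S s ->
    exists D', delta D D' = s /\ delta C D' = w * s.

Definition building : Prop := [/\ WD1, WD2 & WD3].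

End Building.

(* Main.v *)
Require Import Defs.
From Stdlib Require Import Relations.
From mathcomp Require Import all_boot.
From mathcomp Require Import boolp classical_sets.

(** Everything rests on the length function [l] of the Coxeter group.  A
    reflection [t] is an inversion of [w] when it occurs an odd number of times
    among the reflections [s1 .. s(i-1) si s(i-1) .. s1] attached to a word
    [s1 .. sn] for [w].  The parity of this number satisfies a cocycle identity
    and vanishes on the relators, so the presentation makes it a function of
    [w] alone.  It follows that [l (t * w) < l w] exactly when [t] is an
    inversion of [w] ([word_length_reflection]), a form of the strong exchange
    condition.  Two consequences carry the comparison of the axioms: [l w] and
    [l (w * s)] always differ, and inserting [s] in a product [x * y] raises it
    in the Bruhat order as soon as [x < x * s] and [y < s * y]
    ([bruhat_le_insert]).

    From a building to a W-groupoid, only the triangle inequality (WG2) is not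
    immediate.  It is proved by following a gallery of reduced type from [D] to
    [E] ([bruhat_le_building]).  The first step from [D], of type [s], either
    multiplies [delta C D = v] by [s], as required, or leaves it unchanged; the
    latter only happens when [v * s < v], and then [bruhat_le_insert] shows that
    the value obtained is even larger than the one required.

    From a W-groupoid to a building, write [d] for the function on pairs of
    chambers.  The triangle inequality and strictness give
    [d D C = (d C D)^-1].  For [d D E = s] the triangle inequality holds for
    both [C, D, E] and [C, E, D]; when [w = d C D] satisfies [w < w * s], the
    two bounds leave [w * s] as the only value of [d C E], because multiplying
    by [s] changes the length by at most one ([distance_up]).  When
    [w * s < w], (WG3) provides a chamber [F] in the s-panel of [D] with
    [d C F = w * s], and the previous case applies to [F] instead of [D]. *)

Set Implicit Arguments.
Unset Strict Implicit.
Unset Printing Implicit Defensive.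

(** * Inversions of a word *)

Section Inversions.
Local Open Scope group_scope.
Variable W : groupType.
Implicit Types (u v : seq W) (s t r x y w : W).

Lemma word_value_nil : word_value (W := W) [::] = 1.
Proof. exact: big_nil. Qed.

Lemma word_value_cons x u : word_value (x :: u) = x * word_value u.
Proof. exact: big_cons. Qed.

Lemma word_value_cat u v : word_value (u ++ v) = word_value u * word_value v.
Proof. exact: big_cat. Qed.

(** For [u = s1 .. sn], the parity of the number of indices [i] such that [t]
    is the reflection [s1 .. s(i-1) si s(i-1) .. s1] (the letters being
    involutions). *)
Fixpoint inversion_parity u t : bool :=
  if u is x :: u' then (x == t) (+) inversion_parity u' (t ^ x) else false.

(** The cocycle identity [N(u v) = N(u) + u N(v) u^-1] for sets of inversions,
    where + is the symmetric difference. *)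
Lemma inversion_parity_cat u v t :
  inversion_parity (u ++ v) t =
  inversion_parity u t (+) inversion_parity v (t ^ word_value u).
Proof.
elim: u t => [|x u IH] t /=; first by rewrite word_value_nil conjg1.
by rewrite IH word_value_cons conjgM addbA.
Qed.

Lemma relatorS s t k : relator s t k.+1 = [:: s, t & relator s t k].
Proof. by []. Qed.

Lemma word_value_relator s t k : word_value (relator s t k) = (s * t) ^+ k.
Proof.
elim: k => [|k IH]; first exact: word_value_nil.
by rewrite relatorS !word_value_cons IH expgS mulgA.
Qed.

(** In the dihedral group, conjugation by the rotation [s * t] shifts the
    reflections [(s * t)^j * s] by two. *)
Lemma conjg_dihedral s t j : s * s = 1 -> t * t = 1 ->
  ((s * t) ^+ j * s) ^ (s * t)^-1 = (s * t) ^+ j.+2 * s.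
Proof.
move=> ss tt; rewrite conjgE invgK -[in RHS](addn2 j) addnC expgnDr expg2.
rewrite invgM (mulg1_eq ss) (mulg1_eq tt) -!mulgA; congr (s * (t * _)).
rewrite !mulgA; congr (_ * s).
rewrite -[(s * t) ^+ j * s * t]mulgA -expgSr expgS -!mulgA; congr (s * (t * _)).
Qed.

(** The reflections attached to the word [(s t)^k] are the [(s * t)^j * s] for
    [j < 2k], in this order. *)
Lemma inversion_parity_relator s t k r : s * s = 1 -> t * t = 1 ->
  inversion_parity (relator s t k) r =
  \big[addb/false]_(0 <= j < k + k) ((s * t) ^+ j * s == r).
Proof.
move=> ss tt; elim: k r => [|k IH] r; first by rewrite big_geq.
rewrite relatorS /= IH addnS addSn big_nat_recl // big_nat_recl // mul1g.
congr (_ (+) (_ (+) _)).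
  by rewrite -(inj_eq (@conjg_inj _ s^-1)) conjgK conjgE invgK (mulg1_eq ss) mulgA.
apply: eq_bigr => j _; rewrite -conjgM.
by rewrite -(inj_eq (@conjg_inj _ (s * t)^-1)) conjgK conjg_dihedral.
Qed.

(** When [(s * t)^k = 1], the list of these [2k] reflections repeats itself
    after [k] terms, so each reflection occurs an even number of times. *)
Lemma inversion_parity_relator0 s t k r :
  s * s = 1 -> t * t = 1 -> (s * t) ^+ k = 1 ->
  inversion_parity (relator s t k) r = false.
Proof.
move=> ss tt stk; rewrite inversion_parity_relator //.
rewrite (big_cat_nat (n := k)) ?leq_addr //=.
rewrite -[X in _ (+) \big[_/_]_(X <= _ < _) _]add0n big_addn addnK.
rewrite [X in _ (+) X](eq_bigr (fun j => (s * t) ^+ j * s == r)) ?addbb //.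
by move=> j _; rewrite expgnDr stk mulg1.
Qed.

End Inversions.

(** * Inversions of an element of a Coxeter group *)

Section Exchange.
Local Open Scope group_scope.
Variables (W : groupType) (S : set W) (hW : coxeter_system S).
Implicit Types (u v : seq W) (s t r x y w : W).
Notation l := (word_length S).

Lemma is_word_nil : is_word S [::].
Proof. by []. Qed.

Lemma is_word_cons x u : S x -> is_word S u -> is_word S (x :: u).
Proof. by move=> Sx Su y; rewrite in_cons => /orP[/eqP->|/Su]. Qed.

Lemma is_word_consP x u : is_word S (x :: u) -> S x /\ is_word S u.
Proof.
move=> Su; split; first by apply: Su; rewrite mem_head.
by move=> y yu; apply: Su; rewrite in_cons yu orbT.
Qed.

Lemma is_word_cat u v : is_word S u -> is_word S v -> is_word S (u ++ v).
Proof. by move=> Su Sv y; rewrite mem_cat => /orP[/Su|/Sv]. Qed.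

Lemma is_word_catP u v : is_word S (u ++ v) -> is_word S u /\ is_word S v.
Proof. by move=> Suv; split=> y yu; apply: Suv; rewrite mem_cat yu ?orbT. Qed.

Lemma is_word_rev u : is_word S u -> is_word S (rev u).
Proof. by move=> Su y; rewrite mem_rev => /Su. Qed.

Lemma generator_involution s : S s -> s * s = 1.
Proof.
case: hW => m mP [_ mrel _] Ss; have [mss _ _] := mP _ _ Ss Ss.
by have := mrel _ _ Ss Ss; rewrite mss expg1.
Qed.

Lemma generatorV s : S s -> s^-1 = s.
Proof. by move=> /generator_involution/mulg1_eq. Qed.

Lemma generatorK s w : S s -> w * s * s = w.
Proof. by move=> /generator_involution ss; rewrite -mulgA ss mulg1. Qed.

Lemma ex_word w : exists2 u, is_word S u & word_value u = w.
Proof. by case: hW => m _ []. Qed.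

Lemma word_value_rev u : is_word S u -> word_value (rev u) = (word_value u)^-1.
Proof.
elim: u => [|x u IH]; first by rewrite word_value_nil invg1.
move=> /is_word_consP[Sx Su]; rewrite rev_cons -cats1 word_value_cat IH //.
by rewrite !word_value_cons word_value_nil mulg1 invgM (generatorV Sx).
Qed.

Lemma insert_relator_inversion_parity m u v t :
  (forall s r, S s -> S r -> (s * r) ^+ m s r = 1) ->
  insert_relator S m u v -> inversion_parity u t = inversion_parity v t.
Proof.
move=> mrel [u1 u2 s r _ _ Ss Sr]; rewrite !inversion_parity_cat.
rewrite word_value_relator mrel // conjg1.
by rewrite inversion_parity_relator0 ?mrel //; exact: generator_involution.
Qed.

Lemma inversion_parity_value1 u t : is_word S u -> word_value u = 1 ->
  inversion_parity u t = false.
Proof.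
case: hW => m _ [_ mrel mpres] Su /(mpres _ Su).
rewrite -[false]/(inversion_parity [::] t).
elim=> [v v' vv'|v|v v' _ ->|v1 v2 v3 _ -> _ ->] //.
exact: insert_relator_inversion_parity vv'.
Qed.

(** Two words with the same value have a common inverse word [rev v], and the
    cocycle identity lets the contribution of [rev v] be cancelled. *)
Lemma inversion_parity_word u v t : is_word S u -> is_word S v ->
  word_value u = word_value v -> inversion_parity u t = inversion_parity v t.
Proof.
move=> Su Sv uv; have SVv := is_word_rev Sv.
apply: (@addIb (inversion_parity (rev v) (t ^ word_value v))).
rewrite -inversion_parity_cat -uv -inversion_parity_cat.
by rewrite !inversion_parity_value1 ?word_value_cat ?word_value_rev ?uv ?mulgV //;
  exact: is_word_cat.
Qed.

(** If [t] is the reflection attached to the i-th letter of [u], then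
    multiplying by [t] on the left deletes this letter. *)
Lemma inversion_deletion u t : is_word S u -> inversion_parity u t ->
  exists v, [/\ is_word S v, word_value v = t * word_value u
              & size v < size u].
Proof.
elim: u t => // x u IH t /is_word_consP[Sx Su] /=.
have [<- _|_ /= ut] := eqVneq x t.
  by exists u; rewrite word_value_cons mulgA generator_involution // mul1g.
have [v [Sv vE vu]] := IH _ Su ut; exists (x :: v); split=> //.
  exact: is_word_cons.
by rewrite !word_value_cons vE conjgE !mulgA mulgV mul1g.
Qed.

(** Every reflection [t = x^-1 * s * x] is an inversion of itself: compare the
    word [x^-1 s x] with [x^-1 x], whose inversions cancel.  The middle letter
    contributes [t] exactly once. *)
Lemma reflection_inversion_parity u t :
  reflection S t -> is_word S u -> word_value u = t -> inversion_parity u t.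
Proof.
move=> [s [x [Ss ->]]] Su uE; have [p Sp pE] := ex_word x.
have SVp := is_word_rev Sp.
rewrite (inversion_parity_word (v := rev p ++ s :: p)) //; first last.
- by rewrite uE word_value_cat word_value_cons word_value_rev // pE -conjgE.
- by apply: is_word_cat => //; exact: is_word_cons.
have: inversion_parity (rev p ++ p) (s ^ x) = false.
  apply: inversion_parity_value1; first exact: is_word_cat.
  by rewrite word_value_cat word_value_rev // mulVg.
rewrite !inversion_parity_cat word_value_rev // pE conjgK /= eqxx.
by rewrite [s ^ s]conjgE mulKg addbCA => ->.
Qed.

(** * Word length and the strong exchange condition *)

Lemma word_lengthP w :
  has_expression S w (l w) /\ forall k, has_expression S w k -> l w <= k.
Proof.
suff: exists n, has_expression S w n /\ forall k, has_expression S w k -> n <= k.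
  exact: xgetPex.
have [u Su uE] := ex_word w.
have ex : exists n, `[< has_expression S w n >].
  by exists (size u); apply/asboolP; exists u.
case: (ex_minnP ex) => n /asboolP wn minn; exists n; split=> // k wk.
by apply: minn; apply/asboolP.
Qed.

Definition reduced u : Prop := is_word S u /\ l (word_value u) = size u.

Lemma ex_reduced w : exists2 u, reduced u & word_value u = w.
Proof.
by have [[u [Su uE sz]] _] := word_lengthP w; exists u => //; split; rewrite // uE.
Qed.

Lemma word_length_le_size u : is_word S u -> l (word_value u) <= size u.
Proof. by move=> Su; apply: (word_lengthP _).2; exists u. Qed.

Lemma word_length1 : l 1 = 0%N.
Proof. by have := word_length_le_size is_word_nil; rewrite word_value_nil leqn0 => /eqP. Qed.

Lemma word_length_eq0 w : l w = 0%N -> w = 1.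
Proof.
have [u [_ uE] <-] := ex_reduced w; rewrite uE => /size0nil ->.
exact: word_value_nil.
Qed.

Lemma word_lengthM x y : l (x * y) <= l x + l y.
Proof.
have [u [Su uE] <-] := ex_reduced x; have [v [Sv vE] <-] := ex_reduced y.
rewrite uE vE -word_value_cat -size_cat.
by apply: word_length_le_size; exact: is_word_cat.
Qed.

Lemma reduced_catP u v : reduced (u ++ v) -> reduced u /\ reduced v.
Proof.
rewrite /reduced word_value_cat size_cat => -[/is_word_catP[Su Sv] uv].
have leu := word_length_le_size Su; have lev := word_length_le_size Sv.
have := word_lengthM (word_value u) (word_value v); rewrite uv => le.
split; split=> //; apply/eqP; rewrite eqn_leq ?leu ?lev /=.
  by rewrite -(leq_add2r (size v)) (leq_trans le) // leq_add2l.
by rewrite -(leq_add2l (size u)) (leq_trans le) // leq_add2r.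
Qed.

Lemma reflectionK t w : reflection S t -> t * (t * w) = w.
Proof.
move=> [s [x [Ss ->]]].
by rewrite mulgA -conjMg generator_involution // conj1g mul1g.
Qed.

Lemma word_length_inversion u t : is_word S u -> inversion_parity u t ->
  l (t * word_value u) < l (word_value u).
Proof.
move=> Su ut; have [v [Sv vE] vu] := ex_reduced (word_value u).
move: ut; rewrite (inversion_parity_word t Su Sv) // => vt.
have [v' [Sv' v'E ltv]] := inversion_deletion Sv vt.
by rewrite -vu vE -v'E (leq_ltn_trans _ ltv) // word_length_le_size.
Qed.

(** If [t] is not an inversion of [w], then it is one of [t * w], because it is
    an inversion of itself; hence [w = t * (t * w)] is shorter than [t * w]. *)
Lemma word_length_noninversion u t : reflection S t -> is_word S u ->
  ~~ inversion_parity u t -> l (word_value u) < l (t * word_value u).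
Proof.
move=> tR Su ut; have [v Sv vE] := ex_word t.
have /word_length_inversion : inversion_parity (v ++ u) t.
  rewrite inversion_parity_cat vE (reflection_inversion_parity tR Sv vE).
  by rewrite conjgE mulKg.
rewrite word_value_cat vE (reflectionK _ tR); apply.
exact: is_word_cat.
Qed.

Lemma word_length_reflection u t : reflection S t -> is_word S u ->
  (l (word_value u) < l (t * word_value u)) = ~~ inversion_parity u t.
Proof.
move=> tR Su; apply/idP/idP; last exact: word_length_noninversion.
by apply: contraL => /(word_length_inversion Su)/ltnW; rewrite leqNgt.
Qed.

Lemma reflection_conj s x : S s -> reflection S (s ^ x).
Proof. by move=> Ss; exists s, x. Qed.

Lemma word_length_neq_generator w s : S s -> l (w * s) != l w.
Proof.
move=> Ss; have [u Su <-] := ex_word w; set x := word_value u.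
rewrite (conjgCV x s); have tR := reflection_conj x^-1 Ss.
case ut : (inversion_parity u (s ^ x^-1)).
  by rewrite neq_ltn word_length_inversion.
by rewrite neq_ltn word_length_noninversion ?ut ?orbT.
Qed.

Lemma word_length_generatorM w s : S s -> l (w * s) <= (l w).+1.
Proof.
move=> Ss; apply: leq_trans (word_lengthM _ _) _; rewrite -addn1 leq_add2l.
have := word_length_le_size (is_word_cons Ss is_word_nil).
by rewrite word_value_cons word_value_nil mulg1.
Qed.

(** With [t = x * s * x^-1], the element [x * s * y] is [t * (x * y)].  The
    hypotheses say that [t] is not an inversion of [x] and that [s = t ^ x] is
    not one of [y], so by the cocycle identity [t] is not an inversion of
    [x * y]. *)
Lemma word_length_insert x y s : S s ->
  l x < l (x * s) -> l y < l (s * y) -> l (x * y) < l (x * s * y).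
Proof.
move=> Ss; have [u Su <-] := ex_word x; have [v Sv <-] := ex_word y.
have sR : reflection S s by rewrite -[s]conjg1; exact: reflection_conj.
have [t tR us] : exists2 t, reflection S t & word_value u * s = t * word_value u.
  by exists (s ^ (word_value u)^-1); [exact: reflection_conj|exact: conjgCV].
have tu : t ^ word_value u = s by rewrite conjgE -us mulKg.
have Suv := is_word_cat Su Sv.
rewrite us -(mulgA t) -word_value_cat !word_length_reflection //.
by rewrite inversion_parity_cat tu => /negPf-> /negPf->.
Qed.

(** * Bruhat order *)

Lemma bruhat_le_length x y : bruhat_le S x y -> x = y \/ l x < l y.
Proof.
elim=> [{}x {}y [t []]|{}x|{}x {}y z _ IHxy _ IHyz]; [by right|by left|].
case: IHxy => [->|xy] //; case: IHyz => [<-|yz]; first by right.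
by right; exact: ltn_trans yz.
Qed.

Lemma bruhat_le_leq x y : bruhat_le S x y -> l x <= l y.
Proof. by move=> /bruhat_le_length[->|/ltnW]. Qed.

Lemma bruhat_le_insert x y s : S s ->
  l x < l (x * s) -> l y < l (s * y) -> bruhat_le S (x * y) (x * s * y).
Proof.
move=> Ss lx ly; apply: rt_step; exists (s ^ y); split.
- exact: reflection_conj.
- by rewrite -(mulgA x y) -conjgC mulgA.
- exact: word_length_insert.
Qed.

Lemma bruhat_lt_up x s : S s -> bruhat_lt S x (x * s) <-> l x < l (x * s).
Proof.
move=> Ss; split=> [[/bruhat_le_length[]]//|lx]; split.
  apply: rt_step; exists s; split=> //.
  by rewrite -[s]conjg1; exact: reflection_conj.
by move=> xE; rewrite -xE ltnn in lx.
Qed.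

Lemma bruhat_lt_down x s : S s -> bruhat_lt S (x * s) x <-> l (x * s) < l x.
Proof.
by move=> Ss; have := bruhat_lt_up (x * s) Ss; rewrite generatorK.
Qed.

End Exchange.

(** * From buildings to W-groupoids *)

Section BuildingToGroupoid.
Local Open Scope group_scope.
Variables (W : groupType) (S : set W) (hW : coxeter_system S).
Variables (Delta : Type) (delta : Delta -> Delta -> W).
Hypothesis delta_building : building S delta.
Notation l := (word_length S).

Lemma building_diag C : delta C C = 1.
Proof. by case: delta_building => d1 _ _; apply/d1. Qed.

(** By (WD3) some chamber [E] satisfies [delta D E = s] and
    [delta C E = s * s = 1], and (WD1) gives [E = C]. *)
Lemma building_panel C D s : S s -> delta C D = s -> delta D C = s.
Proof.
case: delta_building => d1 _ d3 Ss CD.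
have [E [DE]] := d3 _ _ _ _ CD Ss.
by rewrite (generator_involution hW Ss) => /d1 CE; rewrite CE.
Qed.

(** The axioms of a building only describe moves of the second argument of
    [delta], so the last letter of the word is peeled off by (WD3) and put back
    by (WD2), leaving the first letter for the induction. *)
Lemma gallery_first_step s u C D :
  reduced S (s :: u) -> delta C D = word_value (s :: u) ->
  exists2 E, delta C E = s & delta E D = word_value u.
Proof.
case: delta_building => d1 d2 d3.
elim/last_ind: u D => [|u r IH] D red; rewrite word_value_cons.
  rewrite word_value_nil mulg1 => CD; exists D => //; exact: building_diag.
move=> CD; have Sr : S r.
  by case: red => Sw _; apply: Sw; rewrite in_cons mem_rcons mem_head orbT.
have [ured _] : reduced S (s :: u) /\ reduced S [:: r].
  by apply: reduced_catP => //; rewrite /= cats1.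
have [_ redr] : reduced S [:: s] /\ reduced S (rcons u r).
  exact: (reduced_catP hW (u := [:: s])).
have [redu _] : reduced S u /\ reduced S [:: r].
  by apply: reduced_catP => //; rewrite cats1.
have [D' [DD' CD']] := d3 _ _ _ _ CD Sr.
have [] := IH D' ured.
  rewrite CD' -cats1 word_value_cat !word_value_cons word_value_nil mulg1.
  by rewrite mulgA (generatorK hW).
move=> E CE ED'; exists E => //.
have [_ d2up] := d2 _ _ D _ _ ED' Sr (building_panel Sr DD').
have uE : word_value u * r = word_value (rcons u r).
  by rewrite -cats1 word_value_cat word_value_cons word_value_nil mulg1.
rewrite -uE; apply: d2up; apply/(bruhat_lt_up _ Sr).
by rewrite uE redr.2 size_rcons redu.2.
Qed.

(** (WG2) for a building, by induction on a reduced type of a gallery from [D]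
    to [E]. *)
Lemma bruhat_le_building u C D E : reduced S u -> delta D E = word_value u ->
  bruhat_le S (delta C D * delta D E) (delta C E).
Proof.
case: (delta_building) => d1 d2 d3.
elim: u D => [|s u IH] D red DE.
  have <- : D = E by apply/d1; rewrite DE word_value_nil.
  by rewrite building_diag mulg1; exact: rt_refl.
have [Ss uw] := is_word_consP red.1.
have [_ ured] : reduced S [:: s] /\ reduced S u by exact: (reduced_catP hW).
have [D1 DD1 D1E] := gallery_first_step red DE.
have {IH} := IH D1 ured D1E; have [d2down d2up] := d2 C D D1 _ s erefl Ss DD1.
set v := delta C D in d2down d2up *; rewrite D1E DE word_value_cons mulgA.
have := word_length_neq_generator hW v Ss; rewrite neq_ltn => /orP[lv|lv]; last first.
  by rewrite d2up //; exact/bruhat_lt_up.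
(* The remaining case is [delta C D1 = v] with [v * s < v]; for [x = v * s] and
   [y] the value of [u], the product [v * s * y] is [x * y] and the
   available lower bound [v * y] is [x * s * y]. *)
case: d2down => [|->|->] //; first exact/bruhat_lt_down.
apply: rt_trans; rewrite -{2}(generatorK hW v Ss).
apply: bruhat_le_insert; rewrite ?(generatorK hW) //.
by have := red.2; rewrite word_value_cons => ->; rewrite ured.2 /=.
Qed.

Lemma strict_W_groupoid_of_building (G : groupoid Delta) :
  connected G -> simply_connected G ->
  strict_W_groupoid S (fun (C D : Delta) (_ : edge G C D) => delta C D).
Proof.
case: (delta_building) => d1 d2 d3 cG sG; split; first split.
- move=> C s Ss; have [D [CD _]] := d3 _ _ _ _ (building_diag C) Ss.
  by exists D, (the_edge cG C D).
- exact: building_diag.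
- move=> C D E _ _; have [u red uE] := ex_reduced hW (delta D E).
  exact: (bruhat_le_building _ red).
- move=> C D g s Ss _; have [E [DE CE]] := d3 C D _ s erefl Ss.
  exists E, (the_edge cG C E); split; last exact: CE.
  exact: building_panel.
- by move=> C D g /d1 CD; move: g; rewrite CD => g; rewrite (sG _ g).
Qed.

End BuildingToGroupoid.

(** * From W-groupoids to buildings *)

Section GroupoidToBuilding.
Local Open Scope group_scope.
Variables (W : groupType) (S : set W) (hW : coxeter_system S).
Variables (Delta : Type) (G : groupoid Delta).
Hypotheses (cG : connected G) (sG : simply_connected G).
Variable delta : forall C D : Delta, edge G C D -> W.
Hypothesis delta_groupoid : strict_W_groupoid S delta.
Notation l := (word_length S).
Notation d C D := (delta (the_edge cG C D)).

Lemma distance_edge C D (g : edge G C D) : delta g = d C D.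
Proof. by rewrite [g](the_edge_unique cG sG). Qed.

Lemma distance_eq1 C D : C = D <-> d C D = 1.
Proof.
case: (delta_groupoid) => -[_ g1 _ _] st; split=> [->|/st[]] //.
by rewrite -(distance_edge (ident G D)); exact: g1.
Qed.

Lemma distance_triangle C D E : bruhat_le S (d C D * d D E) (d C E).
Proof.
case: (delta_groupoid) => -[_ _ g2 _] _.
by rewrite -(distance_edge (Defs.comp (the_edge cG C D) (the_edge cG D E))); exact: g2.
Qed.

(** The triangle inequality gives [d C D * d D C <= 1], and nothing is smaller
    than 1 in the Bruhat order. *)
Lemma distance_opposite C D : d D C = (d C D)^-1.
Proof.
apply/esym/mulg1_eq; have := distance_triangle C D C.
have /distance_eq1-> // : C = C by [].
by case/bruhat_le_length => //; rewrite word_length1.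
Qed.

Lemma distance_panel C D s : S s -> d C D = s -> d D C = s.
Proof. by move=> Ss CD; rewrite distance_opposite CD; exact: (generatorV hW). Qed.

(** If [d C E] were not [w * s] for [w = d C D], the triangle inequality would
    make it strictly longer, hence at least two letters longer than [w]; but
    [d C E * s <= w] in the Bruhat order, by the triangle inequality for
    [C, E, D]. *)
Lemma distance_up C D E s : S s -> d D E = s ->
  l (d C D) < l (d C D * s) -> d C E = d C D * s.
Proof.
move=> Ss DE lw; have := distance_triangle C D E; rewrite DE.
case/bruhat_le_length => [//|lt].
have := distance_triangle C E D; rewrite (distance_panel Ss DE).
move/bruhat_le_leq => le.
have := word_length_generatorM hW (d C E * s) Ss; rewrite (generatorK hW) // => le2.
have le3 : l (d C D * s) <= l (d C E * s) := leq_trans lt le2.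
by have := leq_trans le3 le; rewrite leqNgt lw.
Qed.

Lemma distance_down C D s : S s -> l (d C D * s) < l (d C D) ->
  exists2 E, d E D = s & d C E = d C D * s.
Proof.
case: (delta_groupoid) => -[_ _ _ g3] _ Ss /(bruhat_lt_down hW _ Ss) lt.
have [E [h [hD hC]]] := g3 _ _ _ _ Ss lt.
by exists E; rewrite -?hC -?hD distance_edge.
Qed.

(** The triangle inequality for [E, F, D] gives [d E F * s <= s], and only 1
    and [s] lie below [s]. *)
Lemma distance_same_panel D E F s :
  S s -> d E D = s -> d D F = s -> E = F \/ d E F = s.
Proof.
move=> Ss ED DF; have := distance_triangle E F D.
rewrite (distance_panel Ss DF) ED => /bruhat_le_length[EFs|lt].
  by left; apply/distance_eq1; rewrite -(generatorK hW (d E F) Ss) EFs (generator_involution hW).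
right; rewrite -(generatorK hW (d E F) Ss) (@word_length_eq0 _ _ hW (d E F * s)) ?mul1g //.
have := word_length_generatorM hW 1 Ss; rewrite mul1g word_length1 // => ls.
by apply/eqP; rewrite -leqn0 -ltnS (leq_trans lt).
Qed.

Lemma building_of_strict_W_groupoid : building S (fun C D => d C D).
Proof.
split.
- exact: distance_eq1.
- move=> C D E w s <- Ss DE; split; last first.
    by move/(bruhat_lt_up _ Ss); exact: distance_up.
  move/(bruhat_lt_down hW _ Ss) => lw; have [F FD CF] := distance_down Ss lw.
  have [<-|FE] := distance_same_panel Ss FD DE; [by left|right].
  by rewrite (distance_up Ss FE) CF (generatorK hW).
- move=> C D w s <- Ss.
  have := word_length_neq_generator hW (d C D) Ss; rewrite neq_ltn => /orP[lw|lw].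
    have [E ED CE] := distance_down Ss lw; exists E; split=> //.
    exact: distance_panel.
  case: (delta_groupoid) => -[/(_ D s Ss)[E [g]]] gE _ _ _ _.
  have DE : d D E = s by rewrite -(distance_edge g).
  by exists E; split=> //; exact: distance_up.
Qed.

End GroupoidToBuilding.

Theorem mainTheorem1 (W : groupType) (S : set W) (hW : coxeter_system S) :
  (forall (Delta : Type) (delta : Delta -> Delta -> W),
     building S delta ->
     forall G : groupoid Delta, connected G -> simply_connected G ->
       strict_W_groupoid S (fun (C D : Delta) (_ : edge G C D) => delta C D))
  /\
  (forall (Delta : Type) (G : groupoid Delta)
     (cG : connected G) (sG : simply_connected G)
     (delta : forall C D : Delta, edge G C D -> W),
     strict_W_groupoid S delta ->
     building S (fun C D : Delta => delta C D (the_edge cG C D))).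
Proof.
split=> [Delta delta|Delta G cG sG delta] deltaP.
  exact: strict_W_groupoid_of_building.
exact: building_of_strict_W_groupoid.
Qed.
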